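(* Let $n\ge 1$ and let $c_0,\dots,c_n$ be non-negative integers with $\sum_{i=0}^n c_i=n$. Assume that initially there are $c_i$ coins at vertex $i$, $i=0,1,\dots,n$, of a regular $(n+1)$-gon, and run the robbing process until it terminates. Then the probability $\operatorname{prob}(c_0,c_1,\dots,c_n)$ that vertex $n$ is empty in the final configuration equals $$\frac{1}{n!}\,\Phi\left(\prod_{i=0}^n y_i^{c_i}\right),$$ where $y_i=x_0+x_1+\dots+x_i$.
   Context: Divided symmetrization for the path: for a polynomial $f(x_0,\dots,x_n)$, $$\Phi(f)=\operatorname{Sym}\left(\frac{f}{\prod_{i=0}^{n-1}(x_i-x_{i+1})}\right),$$ where for a rational function $\varphi$, $\operatorname{Sym}\varphi=\sum_{\pi}\varphi(\pi_0,\dots,\pi_n)$ is the sum over all $(n+1)!$ permutations $\pi$ of the variables $x_0,\dots,x_n$. $\Phi(f)$ is a polynomial of degree at most $\deg f-n$, so it is a constant when $\deg f\le n$. Robbing process: $n$ coins are distributed among the vertices of a regular $(n+1)$-gon, enumerated cyclically by $0,1,\dots,n$ (vertex $i$ is adjacent to $i\pm1$ modulo $n+1$). At each step choose any vertex $v$ containing at least 2 coins and rob it: take 1 coin from $v$ and put it to either the left or the right neighbour of $v$, with equal probability (independently of all previous steps). Proceed as long as possible, i.e. until no vertex contains at least 2 coins. With probability 1 the process terminates in finite time, and the distribution of the final configuration does not depend on the choice of the robbed vertex at every step. In a final configuration exactly one vertex is empty and each of the other $n$ vertices contains exactly 1 coin. *)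

(* Defs.v *)
From mathcomp Require Import all_boot all_order all_fingroup all_algebra.
From mathcomp Require Import generic_quotient fraction.
From mathcomp Require Import mpoly.

Set Implicit Arguments.
Unset Strict Implicit.
Unset Printing Implicit Defensive.

Import GRing.Theory.
Local Open Scope ring_scope.

Section DividedSymmetrization.
Variables (R : idomainType) (n : nat).

Definition ratfun := {fraction {mpoly R[n.+1]}}.

Definition polyfun (p : {mpoly R[n.+1]}) : ratfun := FracField.tofrac p.

Definition cstfun (a : R) : ratfun := polyfun a%:MP.

(* [msym s] substitutes 'X_(s i) for every 'X_i. *)
Definition subst_perm (s : 'S_n.+1) (phi : ratfun) : ratfun :=
  polyfun (msym s \n_(repr phi)) / polyfun (msym s \d_(repr phi)).

(* The chosen representative of [phi] is irrelevant. *)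
Lemma subst_perm_frac (s : 'S_n.+1) (p q : {mpoly R[n.+1]}) :
  q != 0 ->
  subst_perm s (polyfun p / polyfun q) =
  polyfun (msym s p) / polyfun (msym s q).
Proof.
move=> q0; rewrite /subst_perm; set phi := (X in repr X).
have msym_neq0 r : r != 0 -> msym s r != 0.
  by apply: contra_neq => h; apply: (inj_msym s); rewrite h msym0.
have pf_neq0 r : r != 0 -> polyfun r != 0 by rewrite /polyfun tofrac_eq0.
have d0 : \d_(repr phi) != 0 by exact: denom_ratioP.
have phiE : phi * polyfun \d_(repr phi) = polyfun \n_(repr phi).
  rewrite -{1}[phi]reprK /polyfun; unlock FracField.tofrac.
  rewrite -[LHS]FracField.pi_mul; apply/eqmodP.
  rewrite /= FracField.equivfE /FracField.mulf.
  by rewrite !numden_Ratio ?mulr1 ?oner_neq0 // mulrC.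
have cross : \n_(repr phi) * q = p * \d_(repr phi).
  apply/eqP; rewrite -tofrac_eq !tofracM -![FracField.tofrac _]/(polyfun _).
  by rewrite -phiE mulrAC /phi divfK ?pf_neq0.
apply/eqP; rewrite eqr_div ?pf_neq0 ?msym_neq0 //.
by rewrite /polyfun -!tofracM -!msymM cross.
Qed.

Definition Sym (phi : ratfun) : ratfun :=
  \sum_(s : 'S_n.+1) subst_perm s phi.

Definition Phi (f : {mpoly R[n.+1]}) : ratfun :=
  Sym (polyfun f / polyfun (\prod_(i < n) ('X_(inord i) - 'X_(inord i.+1)))).

Definition ypoly (i : 'I_n.+1) : {mpoly R[n.+1]} :=
  \sum_(j < n.+1 | (j <= i)%N) 'X_j.

End DividedSymmetrization.

(* Imported only now: its notation [\d_] hides the denominator of a fraction,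
   and importing mpoly after it fails on incompatible notation levels. *)
From mathcomp Require Import all_classical all_reals all_analysis.

Local Open Scope classical_set_scope.

Definition configuration (n : nat) := {ffun 'I_n.+1 -> nat}.

Section Robbing.
Variable n : nat.
Implicit Types (c : configuration n) (v : 'I_n.+1) (b : bool).

Definition final c := [forall v, (c v < 2)%N].

(* [ordS] and [ord_pred] are the successor and predecessor modulo n.+1. *)
Definition neighbour v b : 'I_n.+1 := if b then ordS v else ord_pred v.

(* Truncated subtraction is harmless: [v] holds at least 2 coins when robbed. *)
Definition rob c v b : configuration n :=
  [ffun i => (c i - (i == v) + (i == neighbour v b))%N].

(* State after [k] steps when the [j]-th step robs vertex [vs j] with coin flip
   [bs j]; it is stationary once a final configuration is reached. *)
Fixpoint state c (vs : nat -> 'I_n.+1) (bs : nat -> bool) (k : nat) :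
    configuration n :=
  if k is k'.+1 then
    let c' := state c vs bs k' in
    if final c' then c' else rob c' (vs k') (bs k')
  else c.

Variables (d : measure_display) (T : measurableType d) (R : realType).
Variable P : probability T R.

Definition run c (V : nat -> T -> 'I_n.+1) (B : nat -> T -> bool) k (w : T) :=
  state c (V^~ w) (B^~ w) k.

(* The choices of the robber before the [k]-th flip, and the earlier flips. *)
Definition past (V : nat -> T -> 'I_n.+1) (B : nat -> T -> bool) k
    (vs : nat -> 'I_n.+1) (bs : nat -> bool) : set T :=
  [set w | (forall j, (j <= k)%N -> V j w = vs j) /\
           (forall j, (j < k)%N -> B j w = bs j)].

(* [V k] is the vertex robbed at step [k] and [B k] is the direction of the
   coin.  The choice of [V k] is arbitrary: it may depend on the whole past and
   on extra randomness, provided that the flip [B k] is fair given everything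
   that happened before it, [V k] included.  Once the process has stopped,
   [V] and [B] no longer play any role. *)
Record robbing_process c (V : nat -> T -> 'I_n.+1) (B : nat -> T -> bool) :
    Prop := RobbingProcess {
  robbing_measurable_vertex :
    forall k v, measurable [set w | V k w = v];
  robbing_measurable_flip :
    forall k b, measurable [set w | B k w = b];
  robbing_rule :
    forall k w, ~~ final (run c V B k w) -> (2 <= run c V B k w (V k w))%N;
  robbing_fair :
    forall k vs bs b,
      P (past V B k vs bs `&` [set w | B k w = b]) =
      ((2^-1)%:E * P (past V B k vs bs))%E
}.

Definition ends_empty c (V : nat -> T -> 'I_n.+1) (B : nat -> T -> bool) v :
    set T :=
  [set w | exists k, final (run c V B k w) /\ run c V B k w v = 0%N].

End Robbing.

(* Main.v *)
(** Put [y_i = x_0 + ... + x_i] and consider the function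
    [c |-> Phi (y^c)] on configurations of [n] coins.  Since
    [2 y_v - y_(v-1) - y_(v+1) = x_v - x_(v+1)], multiplying by this second
    difference cancels one factor of the denominator.  Symmetrizing first inside
    the two blocks [x_0..x_v] and [x_(v+1)..x_n], for which [y_v] is invariant,
    leaves an antisymmetric numerator whose degree is too small, because an
    antisymmetric polynomial has distinct exponents inside each block; hence
    [Phi (y_v m (x_v - x_(v+1))) = 0] for [deg m <= n - 2], and likewise
    [Phi (y_n m) = 0] for [deg m < n].  So [c |-> Phi (y^c)] is harmonic for
    the robbing process, vanishes when vertex [n] holds a coin, and equals [n!]
    at the configuration [(1, ..., 1, 0)].

    On the probabilistic side, summing over the empty vertices [e] the expected
    hitting times of [e] from all coins gives a nonnegative function which drops
    by at least 1 on average at every step, whatever the robber does.  Hence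
    the process stops almost surely and harmonic functions are determined by
    their values on final configurations.  Harmonicity is applied
    to the coefficients of the numerator of [Phi (y^c)] over the Vandermonde
    polynomial, which are real numbers. *)

From HB Require Import structures.
Require Import Defs.
From mathcomp Require Import all_boot all_order all_fingroup all_algebra.
From mathcomp Require Import mpoly.
From mathcomp Require Import all_classical all_reals all_analysis.
From mathcomp Require Import zify ring.
Import Order.TTheory GRing.Theory Num.Theory.
Set Implicit Arguments.
Unset Strict Implicit.
Unset Printing Implicit Defensive.
Local Open Scope ring_scope.

(** * Antisymmetric polynomials *)

Section Antisymmetrization.
Variables (R : numDomainType) (n : nat).
Implicit Types (p q : {mpoly R[n.+1]}) (G : {group 'S_n.+1}).

Lemma msymXi (s : 'S_n.+1) i : msym s 'X_i = 'X_(s i) :> {mpoly R[n.+1]}.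
Proof. by rewrite /msym mmapX mmap1U. Qed.

Definition antisym (G : {set 'S_n.+1}) p : {mpoly R[n.+1]} :=
  \sum_(s in G) (-1) ^+ s *: msym s p.

Lemma antisym_is_linear G : linear (antisym G).
Proof.
move=> a p q; rewrite /antisym scaler_sumr -big_split; apply: eq_bigr => s _ /=.
by rewrite msymD msymZ scalerDr !scalerA mulrC.
Qed.

HB.instance Definition _ G :=
  GRing.isLinear.Build R {mpoly R[n.+1]} {mpoly R[n.+1]} _ (antisym G)
    (antisym_is_linear G).

Lemma antisym_msym G (t : 'S_n.+1) p :
  t \in G -> antisym G (msym t p) = (-1) ^+ t *: antisym G p.
Proof.
move=> tG; rewrite /antisym [in RHS](reindex_inj (mulgI t)) /= scaler_sumr.
apply: eq_big => [s|s _]; first by rewrite groupMl.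
by rewrite msymMm scalerA odd_permM signr_addb mulrA -expr2 sqrr_sign mul1r.
Qed.

Lemma msym_antisym G (t : 'S_n.+1) p :
  t \in G -> msym t (antisym G p) = (-1) ^+ t *: antisym G p.
Proof.
move=> tG; rewrite /antisym [in RHS](reindex_inj (mulIg t)) /= scaler_sumr.
rewrite raddf_sum /=.
apply: eq_big => [s|s _]; first by rewrite groupMr.
rewrite msymMm msymZ scalerA odd_permM signr_addb mulrCA -expr2 sqrr_sign.
by rewrite mulr1.
Qed.

(* Restricting the sum to a subgroup fixing [q] factors [q] out. *)
Lemma antisym_invariantM G p q :
  {in G, forall s, msym s q = q} -> antisym G p = 0 ->
  antisym [set: 'S_n.+1] (q * p) = 0.
Proof.
move=> qG p0; have G0 : #|G|%:R != 0 :> R by rewrite pnatr_eq0 -lt0n cardG_gt0.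
apply/eqP; have /eqP := congr1 (fun r => antisym [set: 'S_n.+1] (q * r)) p0.
rewrite mulr0 raddf0 /antisym mulr_sumr -/(antisym _ _) raddf_sum /=.
rewrite (eq_bigr (fun=> antisym [set: 'S_n.+1] (q * p))) => [|s sG].
  by rewrite sumr_const -scaler_nat -mul_mpolyC mulf_eq0 mpolyC_eq0 (negPf G0).
rewrite -mul_mpolyC mulrCA mul_mpolyC linearZ /= -{1}(qG s sG) -msymM antisym_msym ?inE //.
by rewrite scalerA -expr2 sqrr_sign scale1r.
Qed.

Lemma mperm_tperm (m : 'X_{1..n.+1}) i j :
  m i = m j -> [multinom m (tperm i j k) | k < n.+1] = m.
Proof.
move=> mij; apply/mnmP => k; rewrite mnmE.
by case: tpermP => [->|->|].
Qed.

Lemma mcoeff_antisym_tperm G p (m : 'X_{1..n.+1}) i j :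
  i != j -> tperm i j \in G -> m i = m j -> (antisym G p)@_m = 0.
Proof.
move=> ij tG mij; have := congr1 (mcoeff m) (msym_antisym p tG).
rewrite mcoeff_sym mperm_tperm // odd_tperm ij expr1 mcoeffZ mulN1r => /eqP.
by rewrite -addr_eq0 -mulr2n mulrn_eq0 => /eqP.
Qed.

Definition blockpair (S : {set 'I_n.+1}) (p : 'I_n.+1 * 'I_n.+1) :=
  (p.1 < p.2)%N && ((p.1 \in S) == (p.2 \in S)).

Lemma tperm_astabs (S : {set 'I_n.+1}) i j :
  (i \in S) = (j \in S) -> tperm i j \in ('N(S | 'P))%g.
Proof.
move=> ij; rewrite inE; apply/andP; split; first by rewrite inE.
rewrite inE; apply/fintype.subsetP => k kS; rewrite inE /= apermE.
by case: tpermP => [ki|kj|//]; [rewrite -ij -ki|rewrite ij -kj].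
Qed.

(* In a monomial occurring in an antisymmetric polynomial the exponents within
   a block are distinct, so the exponent of [i] is at least the number of
   variables of its block with a smaller exponent. *)
Lemma antisym_lt_degree (S : {set 'I_n.+1}) p k :
  p \is k.-homog -> (k < #|blockpair S|)%N -> antisym 'N(S | 'P)%g p = 0.
Proof.
move=> pk kS; apply/mpolyP => m; rewrite mcoeff0.
have [minj|] := boolP [forall i, forall j,
  (i != j) ==> ((i \in S) == (j \in S)) ==> (m i != m j)]; last first.
  case/forallPn => i /forallPn[j]; rewrite 2!negb_imply => /and3P[ij /eqP Sij].
  rewrite negbK => /eqP mij.
  exact: mcoeff_antisym_tperm ij (tperm_astabs Sij) mij.
have {}minj i j : (i \in S) = (j \in S) -> m i = m j -> i = j.
  move=> Sij mij; apply/eqP/negPn/negP => ij.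
  move/forallP/(_ i)/forallP/(_ j): minj.
  by rewrite ij Sij mij !eqxx.
have mdeg_ge : (#|blockpair S| <= mdeg m)%N.
  pose B := [set p : 'I_n.+1 * 'I_n.+1 |
    ((p.1 \in S) == (p.2 \in S)) && (m p.2 < m p.1)%N].
  pose f (p : 'I_n.+1 * 'I_n.+1) :=
    if (m p.2 < m p.1)%N then p else (p.2, p.1).
  have finj : {in blockpair S &, injective f}.
    move=> [i j] [i' j']; rewrite !unfold_in /blockpair /= /f /=.
    move=> /andP[ij _] /andP[ij' _].
    case: ifP => _; case: ifP => _ [e1 e2]; subst => //;
      by move: (ltn_trans ij ij'); rewrite ltnn.
  rewrite -(card_in_image finj).
  apply: (@leq_trans #|B|).
    apply: subset_leq_card; apply/fintype.subsetP => p' /fintype.imageP[[i j]].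
    rewrite unfold_in /blockpair /= => /andP[ij Sij] ->.
    rewrite /f /= inE; case: (ltngtP (m j) (m i)) => mij /=; rewrite ?Sij ?mij //.
      by rewrite eq_sym Sij.
    have e := minj i j (eqP Sij) (esym mij).
    by move: ij; rewrite e ltnn.
  have -> : #|B| = (\sum_(i < n.+1)
      #|[set j | ((i \in S) == (j \in S)) && (m j < m i)%N]|)%N.
    under [RHS]eq_bigr do rewrite -sum1_card.
    rewrite pair_big_dep /= -sum1_card; apply: eq_bigl => -[i j].
    by rewrite !inE.
  rewrite mdegE; apply: leq_sum => i _.
  set A := [set _ | _].
  have ltA (j : 'I_n.+1) : j \in A -> (m j < m i)%N by rewrite inE => /andP[].
  have [mi0|mi0] := posnP (m i).
    rewrite mi0 leqn0 cards_eq0; apply/eqP/setP => j.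
    by rewrite !inE mi0 ltn0 andbF.
  rewrite -[leqRHS]card_ord.
  pose g (j : 'I_n.+1) : 'I_(m i) := insubd (Ordinal mi0) (m j).
  rewrite -(@card_in_imset _ _ g) ?max_card // => j j' jA j'A /(congr1 val).
  rewrite !val_insubd !ltA //; apply: minj.
  by move: jA j'A; rewrite !inE => /andP[/eqP<- _] /andP[/eqP<- _].
rewrite raddf_sum /= big1 // => s _; rewrite mcoeffZ mcoeff_sym.
rewrite (dhomog_nemf_coeff pk) ?mulr0 //= mdeg_mperm.
by rewrite neq_ltn (leq_trans kS mdeg_ge) orbT.
Qed.

End Antisymmetrization.

(** * Divided symmetrization over a path *)

Section PathDenominator.
Variables (R : numDomainType) (n : nat).
Implicit Types (q m : {mpoly R[n.+1]}).

Definition diffprod (P : pred ('I_n.+1 * 'I_n.+1)) : {mpoly R[n.+1]} :=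
  \prod_(p | P p) ('X_p.1 - 'X_p.2).

Definition vandermonde := diffprod (fun p => p.1 < p.2)%N.

Lemma msym_vandermonde (s : 'S_n.+1) :
  msym s vandermonde = (-1) ^+ s *: vandermonde.
Proof.
pose V (t : 'S_n.+1) : 'M[{mpoly R[n.+1]}]_n.+1 :=
  Vandermonde n.+1 (\row_i - 'X_(t i)).
have detV t : \det (V t) = msym t vandermonde.
  rewrite det_Vandermonde rmorph_prod pair_big_dep /=.
  apply: eq_bigr => p _.
  by rewrite !mxE msymB !msymXi opprK addrC.
have -> : vandermonde = \det (V 1%g) by rewrite detV msym1m.
have -> : msym s (\det (V 1%g)) = \det (V s).
  by rewrite !detV msym1m.
have -> : V s = col_perm s (V 1%g).
  by apply/matrixP => i j; rewrite !mxE perm1.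
rewrite col_permE det_mulmx det_perm mulrC -[RHS]mul_mpolyC rmorphXn /=.
by rewrite mpolyCN mpolyC1 ?odd_permV.
Qed.

Lemma vandermonde_neq0 : vandermonde != 0.
Proof.
apply/prodf_neq0 => p p12; rewrite subr_eq0; apply/eqP => /(congr1 (mcoeff U_(p.1))).
rewrite !mcoeffX eqxx eq_mnm1 -val_eqE gtn_eqF //; apply/eqP.
by rewrite oner_eq0.
Qed.

Definition adjdiff (i : nat) : {mpoly R[n.+1]} :=
  'X_(inord i) - 'X_(inord i.+1).

Definition nonadjprod := diffprod (fun p => (p.1 < p.2) && (p.2 != p.1.+1 :> nat))%N.

Lemma big_adjacent (A : Type) (x0 : A) (op : Monoid.com_law x0)
    (Q : pred nat) (F : 'I_n.+1 * 'I_n.+1 -> A) :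
  \big[op/x0]_(p : 'I_n.+1 * 'I_n.+1 | (p.2 == p.1.+1 :> nat) && Q p.1) F p =
  \big[op/x0]_(i < n | Q i) F (inord i, inord i.+1).
Proof.
transitivity (\big[op/x0]_(i < n.+1 | Q i) \big[op/x0]_(j < n.+1 | j == i.+1 :> nat) F (i, j)).
  rewrite pair_big_dep /=; apply: eq_big => [p|[i j]//]; exact: andbC.
rewrite big_mkcond big_ord_recr /=.
rewrite [X in op _ X](_ : _ = x0) ?Monoid.mulm1; last first.
  case: ifP => // _; apply: big_pred0 => j.
  by rewrite ltn_eqF.
rewrite -big_mkcond; apply: eq_bigr => i _ /=.
rewrite (big_pred1 (inord i.+1)) => [|j]; last first.
  by rewrite -[RHS]val_eqE /= inordK // ltnS.
congr (F (_, _)); apply: val_inj => /=.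
by rewrite inordK // ltnS ltnW.
Qed.

Lemma prod_adjdiff_nonadj : (\prod_(i < n) adjdiff i) * nonadjprod = vandermonde.
Proof.
rewrite /vandermonde /diffprod (bigID (fun p : 'I_n.+1 * 'I_n.+1 => p.2 == p.1.+1 :> nat)) /=.
congr (_ * _).
rewrite -(big_adjacent _ xpredT (fun p => 'X_p.1 - 'X_p.2)); apply: eq_bigl => p.
by rewrite andbT; case: eqP => [->|_]; rewrite ?andbF // ltnSn.
Qed.

Lemma Phi_antisym (f : {mpoly R[n.+1]}) :
  Phi f = polyfun (antisym [set: 'S_n.+1] (f * nonadjprod)) / polyfun vandermonde.
Proof.
have pf0 q : q != 0 -> polyfun q != 0 by rewrite /polyfun tofrac_eq0.
have V0 := vandermonde_neq0.
have P0 : \prod_(i < n) adjdiff i != 0.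
  by move: V0; rewrite -prod_adjdiff_nonadj mulf_eq0 negb_or => /andP[].
have sym0 (s : 'S_n.+1) q : q != 0 -> msym s q != 0.
  by apply: contra_neq => h; apply: (inj_msym s); rewrite h msym0.
rewrite /Phi /Sym /antisym /polyfun raddf_sum mulr_suml.
apply: eq_big => [s|s _]; first by rewrite inE.
rewrite subst_perm_frac //.
change (polyfun (msym s f) / polyfun (msym s (\prod_(i < n) adjdiff i)) =
  polyfun ((-1) ^+ s *: msym s (f * nonadjprod)) / polyfun vandermonde).
apply/eqP; rewrite eqr_div ?pf0 ?sym0 //.
rewrite /polyfun -!tofracM tofrac_eq -scalerAl -msymM -mulrA.
rewrite [nonadjprod * _]mulrC prod_adjdiff_nonadj msymM msym_vandermonde.
rewrite -!mul_mpolyC mulrCA [_ * (_ * vandermonde)]mulrA -mpolyCM -expr2 sqrr_sign.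
by rewrite mpolyC1 mul1r.
Qed.

Lemma dhomog_diffprod P : diffprod P \is #|P|.-homog.
Proof.
rewrite /diffprod -sum1_card; elim/big_rec2: _ => [|p q k _ qk].
  exact: dhomog1.
by apply: dhomogM => //; apply: rpredB; rewrite dhomogX /= mdeg1.
Qed.

Lemma antisym_ypoly_eq0 (u : 'I_n.+1) m k :
  m \is k.-homog -> (k < #|[pred i : 'I_n | i != u :> nat]|)%N ->
  antisym [set: 'S_n.+1]
    (ypoly R u * (\prod_(i < n | i == u :> nat) adjdiff i) * m * nonadjprod) = 0.
Proof.
move=> mk ku; pose S := [set i : 'I_n.+1 | (i <= u)%N].
pose C := diffprod (fun p => (p.1 \in S) && (p.2 \notin S)).
pose E := diffprod (fun p => blockpair S p && (p.2 != p.1.+1 :> nat)).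
have NE : (\prod_(i < n | i == u :> nat) adjdiff i) * nonadjprod = C * E.
  rewrite -(big_adjacent _ (fun i => i == u) (fun p => 'X_p.1 - 'X_p.2)).
  rewrite /nonadjprod /C /E /diffprod.
  rewrite [X in X * _]big_mkcond [X in _ * X]big_mkcond -big_split /=.
  rewrite [X in _ = X * _]big_mkcond [X in _ = _ * X]big_mkcond -big_split /=.
  apply: eq_bigr => -[i j] _; rewrite /blockpair !inE /=.
  case: (ltngtP i j) => ij; case: (leqP i u) => iu; case: (leqP j u) => ju;
   case: (eqVneq (j : nat) i.+1) => ji; case: (eqVneq (i : nat) u) => eiu;
   rewrite /= ?mul1r ?mulr1 //; lia.
have -> : ypoly R u * (\prod_(i < n | i == u :> nat) adjdiff i) * m * nonadjprod =
    (ypoly R u * C) * (m * E).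
  by rewrite -[RHS]mulrA [C * _]mulrCA -NE [m * _]mulrCA !mulrA.
apply: (@antisym_invariantM _ _ 'N(S | 'P)%G).
  move=> s sS; have inS i : (s i \in S) = (i \in S).
    by have := astabs_act i sS; rewrite /= apermE.
  rewrite msymM; congr (_ * _).
    rewrite /ypoly raddf_sum /= [RHS](reindex_inj (@perm_inj _ s)) /=.
    apply: eq_big => [i|i _]; first by have := inS i; rewrite !inE.
    by rewrite msymXi.
  pose h (p : 'I_n.+1 * 'I_n.+1) := (s p.1, s p.2).
  have hinj : injective h by move=> [i j] [i' j'] [/perm_inj-> /perm_inj->].
  rewrite /C /diffprod rmorph_prod [RHS](reindex_inj hinj) /=.
  apply: eq_big => [p|p _]; first by rewrite !inS.
  by rewrite msymB !msymXi.
apply: (@antisym_lt_degree _ _ _ _ _ (dhomogM mk (dhomog_diffprod _))).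
rewrite -[X in (_ < X)%N]sum1_card (bigID (fun p : 'I_n.+1 * 'I_n.+1 => p.2 == p.1.+1 :> nat)) /=.
rewrite [X in (_ < _ + X)%N]sum1_card ltn_add2r (leq_trans ku) // -sum1_card.
rewrite -(big_adjacent _ (fun i => i != u) (fun=> 1%N)).
apply: eq_leq; apply: eq_bigl => -[i j]; rewrite unfold_in /blockpair !inE /=.
case: (ltngtP i j) => ij; case: (leqP i u) => iu; case: (leqP j u) => ju;
   case: (eqVneq (j : nat) i.+1) => ji; case: (eqVneq (i : nat) u) => eiu; lia.
Qed.
End PathDenominator.

Lemma val_neighbour_true n (v : 'I_n.+1) :
  neighbour v true = (if v == n :> nat then 0 else v.+1)%N :> nat.
Proof.
rewrite /=; case: eqP => [->|/eqP vn]; first exact: modnn.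
by rewrite modn_small // ltnS ltn_neqAle vn -ltnS ltn_ord.
Qed.

Lemma val_neighbour_false n (v : 'I_n.+1) :
  neighbour v false = (if v == 0%N :> nat then n else v.-1) :> nat.
Proof.
rewrite /= addnS /=; case: eqP => [->|/eqP v0]; first by rewrite add0n modn_small.
move: v0; rewrite -lt0n => v0; rewrite -[in LHS](prednK v0) addSnnS modnDr modn_small //.
by rewrite prednK // ltnW.
Qed.

Section PathSums.
Variables (R : numDomainType) (n : nat).
Implicit Types (q : {mpoly R[n.+1]}).

(* The empty sum [prefix 0] makes [adjdiff i] a second difference at [i = 0] too. *)
Definition prefix (k : nat) : {mpoly R[n.+1]} := \sum_(j < n.+1 | (j < k)%N) 'X_j.

Lemma prefixS k : (k < n.+1)%N -> prefix k.+1 = prefix k + 'X_(inord k).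
Proof.
move=> kn; rewrite /prefix (bigD1 (inord k)) /= ?inordK // addrC.
congr (_ + _); apply: eq_bigl => j.
by rewrite -val_eqE /= inordK // ltnS ltn_neqAle andbC.
Qed.

Lemma prefix0 : prefix 0 = 0. Proof. exact: big_pred0. Qed.

Lemma adjdiff_prefix i : (i < n)%N ->
  adjdiff R n i = prefix i.+1 *+ 2 - prefix i - prefix i.+2.
Proof.
move=> i_n; rewrite (@prefixS i.+1) ?(@prefixS i) // ?(ltnW i_n) 1?ltnW //.
by rewrite /adjdiff mulr2n; ring.
Qed.

Lemma dhomog_prefix k : prefix k \is 1.-homog.
Proof. by apply: rpred_sum => j _; rewrite dhomogX /= mdeg1. Qed.

Lemma dhomog_adjdiff i : adjdiff R n i \is 1.-homog.
Proof. by apply: rpredB; rewrite dhomogX /= mdeg1. Qed.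

Lemma dhomog_big (I : Type) (r : seq I) (Q : pred I) (F : I -> {mpoly R[n.+1]})
    (e : I -> nat) :
  (forall i, F i \is (e i).-homog) ->
  \prod_(i <- r | Q i) F i \is (\sum_(i <- r | Q i) e i).-homog.
Proof.
move=> Fe; elim/big_rec2: _ => [|i q k _ qk]; first exact: dhomog1.
exact: dhomogM.
Qed.

(* [Phi f] is [Phinum f] divided by the Vandermonde polynomial. *)
Definition Phinum q := antisym [set: 'S_n.+1] (q * nonadjprod R n).

Lemma Phinum_is_linear : linear Phinum.
Proof.
by move=> a p q; rewrite /Phinum mulrDl -scalerAl raddfD /= linearZ.
Qed.

HB.instance Definition _ :=
  GRing.isLinear.Build R {mpoly R[n.+1]} {mpoly R[n.+1]} _ Phinum Phinum_is_linear.

Lemma Phinum_adjdiff_eq0 u q k : (u < n)%N ->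
  q \is k.-homog -> (k.+1 < n)%N -> Phinum (prefix u.+1 * adjdiff R n u * q) = 0.
Proof.
move=> un qk kn.
have uE : (inord u : 'I_n.+1) = u :> nat by rewrite inordK // ltnW.
have := @antisym_ypoly_eq0 R n (inord u) q k qk.
rewrite /ypoly uE (big_pred1 (Ordinal un)) => [|i]; last by rewrite /= -[RHS]val_eqE.
apply.
have := cardC (pred1 (Ordinal un)); rewrite card1 card_ord.
rewrite (@eq_card _ _ [pred i : 'I_n | i != u :> nat]) => [|i]; first by lia.
by rewrite !inE -val_eqE.
Qed.

Lemma Phinum_total_eq0 q k :
  q \is k.-homog -> (k < n)%N -> Phinum (prefix n.+1 * q) = 0.
Proof.
move=> qk kn; have := @antisym_ypoly_eq0 R n ord_max q k qk.
rewrite /= big_pred0 ?mulr1 => [|i]; last by rewrite ltn_eqF.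
apply; rewrite (eq_card (B := xpredT)) ?card_ord // => i.
by rewrite !inE ltn_eqF.
Qed.

Lemma Phinum_prod_adjdiff :
  Phinum (\prod_(i < n) adjdiff R n i) = (n.+1)`!%:R *: vandermonde R n.
Proof.
rewrite /Phinum prod_adjdiff_nonadj /antisym.
rewrite (eq_bigr (fun=> vandermonde R n)) => [|s _].
  by rewrite sumr_const cardsT card_Sn scaler_nat.
by rewrite msym_vandermonde scalerA -expr2 sqrr_sign scale1r.
Qed.

(* Only [k = 0] and [k = n] matter.  Writing [M u] for the value obtained when
   the factor [adjdiff k] is replaced by [prefix u], the vanishing lemmas say
   that [M] is affine on [0, k.+1] and that [M 0 = M k.+2 = 0]. *)
Lemma Phinum_prefix_adjdiff k : (k <= n)%N ->
  Phinum (\prod_(0 <= i < k) prefix i.+1 * \prod_(k <= i < n) adjdiff R n i) *+ k.+1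
  = (n.+1)`!%:R *: vandermonde R n.
Proof.
elim: k => [_|k IH kn].
  by rewrite big_nil mul1r mulr1n big_mkord Phinum_prod_adjdiff.
rewrite -(IH (ltnW kn)); set A := \prod_(0 <= i < k) prefix i.+1.
pose D := \prod_(k.+1 <= i < n) adjdiff R n i; pose M u := Phinum (prefix u * (A * D)).
have A_hom : A \is k.-homog.
  have := dhomog_big (index_iota 0 k) xpredT (fun i => dhomog_prefix i.+1).
  by rewrite sum1_size size_iota subn0.
have D_hom : D \is (n - k.+1).-homog.
  have := dhomog_big (index_iota k.+1 n) xpredT (fun i => dhomog_adjdiff i).
  by rewrite sum1_size size_iota.
have M0 : M 0 = 0 by rewrite /M prefix0 mul0r raddf0.
have Mk2 : M k.+2 = 0.
  have [kn'|] := ltnP k.+1 n; last first.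
    move=> nk; have nE : n = k.+1 by apply/eqP; rewrite eqn_leq nk.
    rewrite /M -[in prefix _]nE; apply: (Phinum_total_eq0 (dhomogM A_hom D_hom)).
    by rewrite nE subnn addn0.
  rewrite /M /D big_ltn // [A * _]mulrCA [prefix _ * _]mulrA.
  pose D' := \prod_(k.+2 <= i < n) adjdiff R n i.
  have D'_hom : D' \is (n - k.+2).-homog.
    have := dhomog_big (index_iota k.+2 n) xpredT (fun i => dhomog_adjdiff i).
    by rewrite sum1_size size_iota.
  apply: (Phinum_adjdiff_eq0 kn' (dhomogM A_hom D'_hom)); lia.
have M_adjdiff u : (u < n)%N ->
    Phinum (adjdiff R n u * (A * D)) = M u.+1 *+ 2 - M u - M u.+2.
  by move=> un; rewrite adjdiff_prefix // !mulrBl mulrnAl !raddfB raddfMn.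
have Mharm u : (u < k)%N -> M u.+2 = M u.+1 *+ 2 - M u.
  move=> uk; apply/eqP; rewrite eq_sym -subr_eq0 -M_adjdiff; last by lia.
  pose A' := \prod_(i < k | i != Ordinal uk) prefix i.+1.
  have A'_hom : A' \is k.-1.-homog.
    have := dhomog_big (index_enum 'I_k) (predC1 (Ordinal uk))
      (fun i => dhomog_prefix i.+1).
    by rewrite sum1_card cardC1 card_ord.
  rewrite /A big_mkord (bigD1 (Ordinal uk)) //= -/A' -mulrA mulrCA mulrA.
  by apply/eqP; apply: (Phinum_adjdiff_eq0 _ (dhomogM A'_hom D_hom)); lia.
have Mlin u : (u <= k)%N -> M u = M 1%N *+ u /\ M u.+1 = M 1%N *+ u.+1.
  elim: u => [|u IHu] uk; first by rewrite M0.
  have [Mu MSu] := IHu (ltnW uk); split=> //.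
  rewrite Mharm // Mu MSu -mulrnA -mulrnBr; last by lia.
  by congr (_ *+ _); lia.
have [Mk MSk] := Mlin k (leqnn k).
have -> : \prod_(0 <= i < k.+1) prefix i.+1 = A * prefix k.+1 by exact: big_nat_recr.
have -> : \prod_(k <= i < n) adjdiff R n i = adjdiff R n k * D by exact: big_ltn.
rewrite -mulrA mulrCA [A * (_ * D)]mulrCA M_adjdiff // Mk2 subr0.
change (M k.+1 *+ k.+2 = (M k.+1 *+ 2 - M k) *+ k.+1).
by rewrite Mk MSk -!mulrnA -mulrnBr -?mulrnA; [congr (_ *+ _)|]; lia.
Qed.

Lemma Phinum_prod_prefix :
  Phinum (\prod_(i < n) prefix i.+1) = n`!%:R *: vandermonde R n.
Proof.
have := Phinum_prefix_adjdiff (leqnn n).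
rewrite [in X in _ * X]big_geq // mulr1 big_mkord factS natrM -scalerA.
rewrite -scaler_nat => /eqP; rewrite -subr_eq0 -scalerBr -mul_mpolyC mulf_eq0.
by rewrite mpolyC_eq0 pnatr_eq0 /= subr_eq0 => /eqP.
Qed.

Definition ymonom (f : 'I_n.+1 -> nat) : {mpoly R[n.+1]} :=
  \prod_(i < n.+1) ypoly R i ^+ f i.

Lemma ymonom_add1 f j :
  ymonom (fun i => f i + (i == j))%N = ymonom f * ypoly R j.
Proof.
rewrite /ymonom (eq_bigr _ (fun i _ => exprD _ _ _)) big_split /=.
congr (_ * _); rewrite (bigD1 j) //= eqxx big1 ?mulr1 // => i /negPf ->.
by rewrite expr0.
Qed.

Lemma dhomog_ymonom f : ymonom f \is (\sum_(i < n.+1) f i).-homog.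
Proof.
apply: dhomog_big => i.
by have := dhomogMn (f i) (dhomog_prefix i.+1); rewrite mul1n.
Qed.

Lemma Phinum_rob (c : configuration n) v :
  (\sum_(i < n.+1) c i = n)%N -> (2 <= c v)%N ->
  Phinum (ymonom (rob c v true)) + Phinum (ymonom (rob c v false)) =
  Phinum (ymonom c) *+ 2.
Proof.
move=> cn cv; pose f i := (c i - (i == v).*2)%N.
have fE (i : 'I_n.+1) : (c i = f i + (i == v) + (i == v))%N.
  rewrite /f; case: eqP => [->|_]; last by rewrite subn0 !addn0.
  by rewrite -addnA subnK.
have ycE : ymonom c = ymonom f * ypoly R v * ypoly R v.
  by rewrite -!ymonom_add1; apply: eq_bigr => i _; rewrite fE.
have yrE b : ymonom (rob c v b) = ymonom f * ypoly R v * ypoly R (neighbour v b).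
  rewrite -!ymonom_add1; apply: eq_bigr => i _; rewrite ffunE fE.
  by rewrite addnK.
have fn : (\sum_(i < n.+1) f i + 2 = n)%N.
  rewrite -[RHS]cn (eq_bigr _ (fun i _ => fE i)) !big_split /= -addnA.
  by rewrite -big_mkcond big_pred1_eq.
have y_total q k : q \is k.-homog -> (k < n)%N ->
    Phinum (ypoly R ord_max * q) = 0 by exact: Phinum_total_eq0.
have yE (u : 'I_n.+1) : ypoly R u = prefix u.+1 by [].
have y_hom (u : 'I_n.+1) : ypoly R u \is 1.-homog by exact: (dhomog_prefix u.+1).
have f_hom := dhomog_ymonom f.
rewrite ycE !yrE.
have [vn|vn] := ltnP v n; last first.
  have -> : v = ord_max by apply: val_inj; apply/eqP; rewrite eqn_leq -ltnS ltn_ord.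
  have H u : Phinum (ymonom f * ypoly R ord_max * ypoly R u) = 0.
    by rewrite -mulrA mulrCA (y_total _ _ (dhomogM f_hom (y_hom u))) //; lia.
  by rewrite !H addr0 mul0rn.
have Hv : Phinum (ymonom f * ypoly R v * adjdiff R n v) = 0.
  rewrite -mulrA mulrC yE; apply: (Phinum_adjdiff_eq0 vn f_hom); lia.
have nbt : ypoly R (neighbour v true) = prefix v.+2.
  by rewrite yE val_neighbour_true; case: eqP => // vE; move: vn; rewrite vE ltnn.
have nbf : Phinum (ymonom f * ypoly R v * ypoly R (neighbour v false)) =
    Phinum (ymonom f * ypoly R v * prefix v).
  rewrite [ypoly R (neighbour _ _)]yE val_neighbour_false; case: eqP => [v0|/eqP v0].
    rewrite v0 prefix0 mulr0 raddf0 mulrC.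
    by apply: (Phinum_total_eq0 (dhomogM f_hom (y_hom v))); lia.
  by rewrite prednK // lt0n.
apply/eqP; rewrite nbt nbf addrC -subr_eq0 -opprB oppr_eq0 -Hv.
rewrite adjdiff_prefix // -raddfMn -raddfD -raddfB; apply/eqP; congr (Phinum _).
by rewrite -mulrnAr -mulrDr -mulrBr opprD addrA.
Qed.

Lemma final_filled (c : configuration n) :
  (\sum_(i < n.+1) c i = n)%N -> final c -> c ord_max = 0%N ->
  forall i : 'I_n.+1, c i = (i != ord_max).
Proof.
move=> cn /forallP fc c0; have le1 (i : 'I_n.+1) : (c i <= (i != ord_max))%N.
  by have := fc i; case: eqVneq => [->|_]; rewrite ?c0.
suff /eqP : (\sum_(i < n.+1) ((i != ord_max) - c i) == 0)%N.
  move/eqP; rewrite sum_nat_eq0 => /forallP h i; have := h i; have := le1 i.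
  by move=> /= l /eqP; lia.
rewrite sumnB // cn -big_mkcond /= sum1_card cardC1 card_ord /= subnn //.
Qed.

Lemma Phinum_final (c : configuration n) :
  (\sum_(i < n.+1) c i = n)%N -> final c ->
  Phinum (ymonom c) = ((c ord_max == 0)%N * n`!)%:R *: vandermonde R n.
Proof.
move=> cn fc; case: eqVneq => [c0|c0]; last first.
  have cE (i : 'I_n.+1) : (c i = (c i - (i == ord_max)) + (i == ord_max))%N.
    have [->|_] := eqVneq i ord_max; last by rewrite subn0 addn0.
    by rewrite subn1 addn1 prednK ?lt0n.
  have -> : ymonom c = ymonom (fun i => c i - (i == ord_max))%N * ypoly R ord_max.
    by rewrite -ymonom_add1; apply: eq_bigr => i _; rewrite {1}cE.
  rewrite mul0n scale0r mulrC; apply: (Phinum_total_eq0 (dhomog_ymonom _)).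
  rewrite -[ltnRHS]cn [ltnRHS](eq_bigr _ (fun i _ => cE i)) big_split /=.
  by rewrite -[X in (_ < _ + X)%N]big_mkcond big_pred1_eq addn1.
rewrite mul1n -Phinum_prod_prefix; congr (Phinum _).
rewrite /ymonom big_ord_recr /= c0 mulr1; apply: eq_bigr => i _.
rewrite (final_filled cn fc c0) -val_eqE /= ltn_eqF //.
Qed.
End PathSums.

(** * The robbing process *)

Local Open Scope classical_set_scope.

Section CycleDistance.
Local Open Scope nat_scope.
Variable n : nat.
Implicit Types (s : configuration n) (v e : 'I_n.+1).

(* [d * (n + 1 - d)] does not depend on which of the two arcs between [v] and
   [e] has length [d]; it is the expected time for a simple random walk on the
   cycle to go from [v] to [e]. *)
Definition hitting_time (v e : 'I_n.+1) :=
  ((v - e) + (e - v)) * (n.+1 - ((v - e) + (e - v))).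

Lemma hitting_time_neighbour v e : v != e ->
  hitting_time (neighbour v true) e + hitting_time (neighbour v false) e + 2 =
  (hitting_time v e).*2.
Proof.
rewrite -val_eqE /hitting_time val_neighbour_true val_neighbour_false /=.
have := ltn_ord v; have := ltn_ord e; rewrite !ltnS.
move: (nat_of_ord v) (nat_of_ord e) => {v e}v e en vn ve.
case: (ltngtP v e) ve => // ve _.
  have -> : (v == n) = false by lia.
  have [r rE] : exists r, n = e + r by exists (n - e); lia.
  have [d dE] : exists d, e = v + d.+1 by exists (e - v.+1); lia.
  case: eqP => [v0|/eqP v0]; subst.
    have -> : 1 - (0 + d.+1) + (0 + d.+1 - 1) = d by lia.
    have -> : 0 + d.+1 + r - (0 + d.+1) + (0 + d.+1 - (0 + d.+1 + r)) = r by lia.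
    have -> : 0 - (0 + d.+1) + (0 + d.+1 - 0) = d.+1 by lia.
    have -> : (0 + d.+1 + r).+1 - d = r.+2 by lia.
    have -> : (0 + d.+1 + r).+1 - r = d.+2 by lia.
    have -> : (0 + d.+1 + r).+1 - d.+1 = r.+1 by lia.
    nia.
  have -> : v.+1 - (v + d.+1) + (v + d.+1 - v.+1) = d by lia.
  have -> : v.-1 - (v + d.+1) + (v + d.+1 - v.-1) = d.+2 by lia.
  have -> : v - (v + d.+1) + (v + d.+1 - v) = d.+1 by lia.
  have -> : (v + d.+1 + r).+1 - d = v + r.+2 by lia.
  have -> : (v + d.+1 + r).+1 - d.+2 = v + r by lia.
  have -> : (v + d.+1 + r).+1 - d.+1 = v + r.+1 by lia.
  nia.
have -> : (v == 0) = false by lia.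
have [d dE] : exists d, v = e + d.+1 by exists (v - e.+1); lia.
have [r rE] : exists r, n = v + r by exists (n - v); lia.
case: eqP => [v0|/eqP v0]; subst.
  have -> : r = 0 by lia.
  have -> : 0 - e + (e - 0) = e by lia.
  have -> : (e + d.+1).-1 - e + (e - (e + d.+1).-1) = d by lia.
  have -> : e + d.+1 - e + (e - (e + d.+1)) = d.+1 by lia.
  have -> : (e + d.+1 + 0).+1 - d = e.+2 by lia.
  have -> : (e + d.+1 + 0).+1 - e = d.+2 by lia.
  have -> : (e + d.+1 + 0).+1 - d.+1 = e.+1 by lia.
  nia.
have -> : (e + d.+1).+1 - e + (e - (e + d.+1).+1) = d.+2 by lia.
have -> : (e + d.+1).-1 - e + (e - (e + d.+1).-1) = d by lia.
have -> : e + d.+1 - e + (e - (e + d.+1)) = d.+1 by lia.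
have -> : (e + d.+1 + r).+1 - d = e + r.+2 by lia.
have -> : (e + d.+1 + r).+1 - d.+2 = e + r by lia.
have -> : (e + d.+1 + r).+1 - d.+1 = e + r.+1 by lia.
nia.
Qed.

Definition potential s := \sum_(e | s e == 0) \sum_i s i * hitting_time i e.

Lemma rob_add s v b i : 2 <= s v ->
  rob s v b i + (i == v) = s i + (i == neighbour v b).
Proof. by move=> sv; rewrite ffunE; case: eqP => [->|_] /=; lia. Qed.

Lemma sum_rob s v b (F : 'I_n.+1 -> nat) : 2 <= s v ->
  \sum_i rob s v b i * F i + F v = \sum_i s i * F i + F (neighbour v b).
Proof.
move=> sv; have sum1 w : F w = \sum_i (i == w) * F i.
  by rewrite (bigD1 w) //= eqxx mul1n big1 ?addn0 // => i /negPf->.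
rewrite (sum1 v) [F (neighbour v b)]sum1 -!big_split /=; apply: eq_bigr => i _.
by rewrite -!mulnDl rob_add.
Qed.

Lemma rob_total s v b : 2 <= s v -> \sum_i rob s v b i = \sum_i s i.
Proof.
move=> sv; apply/eqP; rewrite -(eqn_add2r 1); apply/eqP.
have := @sum_rob s v b (fun=> 1) sv.
by under eq_bigr do rewrite muln1; under [in RHS]eq_bigr do rewrite muln1.
Qed.

Lemma potential_rob s v : \sum_i s i = n -> 2 <= s v ->
  potential (rob s v true) + potential (rob s v false) + 2 <= (potential s).*2.
Proof.
move=> sn sv; have le_b b : potential (rob s v b) <=
    \sum_(e | s e == 0) \sum_i rob s v b i * hitting_time i e.
  rewrite /potential !(big_mkcond (fun e => _ == 0)) /=.
  apply: leq_sum => e _; have := @rob_add s v b e sv.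
  case: (rob s v b e =P 0) => [->|//]; case: (s e =P 0) => // se.
  by case: (e =P v) => [->|_] /=; lia.
apply: leq_trans (leq_add (leq_add (le_b true) (le_b false)) (leqnn 2)) _.
have [e0 e0P] : exists e, s e == 0.
  case: (pickP (fun e => s e == 0)) => [e0 s0|s0]; first by exists e0.
  have : \sum_(i < n.+1) 1 <= \sum_i s i.
    by apply: leq_sum => i _; rewrite lt0n s0.
  by rewrite sn sum1_card card_ord ltnn.
rewrite -big_split /= (bigD1 e0) //= addnAC [potential s](bigD1 e0) //= doubleD.
have stepE e : s e == 0 -> \sum_i rob s v true i * hitting_time i e +
    \sum_i rob s v false i * hitting_time i e + 2 =
    (\sum_i s i * hitting_time i e).*2.
  move=> se; have ve : v != e by apply: contraTneq se => <-; lia.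
  have := hitting_time_neighbour ve.
  have := sum_rob true (fun i => hitting_time i e) sv.
  have := sum_rob false (fun i => hitting_time i e) sv.
  by rewrite /=; lia.
rewrite stepE // leq_add2l -muln2 big_distrl /=; apply: leq_sum => e /andP[se _].
by rewrite muln2 -stepE // leq_addr.
Qed.
End CycleDistance.

Section RealProbability.
Variables (d : measure_display) (T : measurableType d) (R : realType).
Variable P : probability T R.

Definition pr (A : set T) : R := fine (P A).

Lemma prE A : measurable A -> P A = (pr A)%:E.
Proof. by move=> mA; rewrite fineK // fin_num_measure. Qed.

Lemma pr_ge0 A : 0 <= pr A.
Proof. exact: fine_ge0. Qed.

Lemma pr0 : pr set0 = 0. Proof. by rewrite /pr measure0. Qed.

Lemma pr_le A A' : measurable A -> measurable A' -> A `<=` A' -> pr A <= pr A'.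
Proof.
by move=> mA mA' AA'; rewrite -lee_fin -!prE //; apply: le_measure; rewrite ?inE.
Qed.

Lemma pr_split (I : finType) (f : T -> I) A :
  measurable A -> (forall i, measurable [set w | f w = i]) ->
  pr A = \sum_i pr (A `&` [set w | f w = i]).
Proof.
move=> mA mf; have mAf i : measurable (A `&` [set w | f w = i]).
  exact: measurableI.
apply: EFin_inj; rewrite -prE // -sumEFin.
rewrite (eq_bigr (fun i => P (A `&` [set w | f w = i]))) => [|i _]; last by rewrite -prE.
have AE : A = \bigcup_(i in [set: I]) (A `&` [set w | f w = i]).
  by apply/seteqP; split=> [w Aw|w [i _ []]//]; exists (f w).
rewrite [in LHS]AE measure_fin_bigcup //; last first.
  apply/trivIsetP => i j _ _ /eqP ij; apply/seteqP; split=> w // -[[_ fi] [_ fj]].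
  by case: ij; rewrite -fi.
  exact: finite_finset.
rewrite (fsbigE (index_enum I)) ?index_enum_uniq //.
  by apply: eq_bigl => i; rewrite in_setT.
by move=> i _; rewrite mem_index_enum.
Qed.

End RealProbability.

Section Histories.
Variables (n : nat) (c : configuration n).
Hypothesis c_total : (\sum_i c i = n)%N.
Variables (d : measure_display) (T : measurableType d) (R : realType).
Variable P : probability T R.
Variables (V : nat -> T -> 'I_n.+1) (B : nat -> T -> bool).
Hypothesis VB : robbing_process P c V B.
Implicit Types (s : configuration n) (vs : nat -> 'I_n.+1) (bs : nat -> bool).

Let X := run c V B.

Definition history k vs bs : set T :=
  [set w | forall j, (j < k)%N -> V j w = vs j /\ B j w = bs j].

Definition upd (A : Type) (u : nat -> A) k a j := if j == k then a else u j.

Lemma history0 vs bs : history 0 vs bs = [set: T].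
Proof. by apply/seteqP; split. Qed.

Lemma historyS k vs bs v b :
  history k.+1 (upd vs k v) (upd bs k b) =
  history k vs bs `&` [set w | V k w = v] `&` [set w | B k w = b].
Proof.
apply/seteqP; split=> w /=.
  move=> h; have := h k (ltnSn k); rewrite /upd eqxx => -[-> ->]; split=> //.
  split=> // j jk; have := h j (ltnW jk); by rewrite /upd ltn_eqF.
move=> [[h hV] hB] j; rewrite ltnS leq_eqVlt /upd => /predU1P[->|jk].
  by rewrite eqxx.
by rewrite ltn_eqF //; exact: h.
Qed.

Lemma past_upd k vs bs v :
  past V B k (upd vs k v) bs = history k vs bs `&` [set w | V k w = v].
Proof.
apply/seteqP; split=> w /=.
  move=> [hV hB]; split; last by have := hV k (leqnn k); rewrite /upd eqxx.
  move=> j jk; split; last exact: hB.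
  by have := hV j (ltnW jk); rewrite /upd ltn_eqF.
move=> [h hV]; split=> j; last by move=> jk; case: (h j jk).
rewrite leq_eqVlt /upd => /predU1P[->|jk]; first by rewrite eqxx.
by rewrite ltn_eqF //; case: (h j jk).
Qed.

Lemma state_ext k vs bs vs' bs' :
  (forall j, (j < k)%N -> vs j = vs' j /\ bs j = bs' j) ->
  state c vs bs k = state c vs' bs' k.
Proof.
elim: k => // k IH h /=; rewrite IH => [|j jk]; last exact/h/ltnW.
by have [-> ->] := h k (ltnSn k).
Qed.

Lemma history_state k vs bs w : history k vs bs w -> X k w = state c vs bs k.
Proof. exact: state_ext. Qed.

Lemma state_upd k vs bs v b :
  state c (upd vs k v) (upd bs k b) k.+1 =
  let s := state c vs bs k in if final s then s else rob s v b.
Proof.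
have -> : state c (upd vs k v) (upd bs k b) k.+1 =
    let s := state c (upd vs k v) (upd bs k b) k in
    if final s then s else rob s (upd vs k v k) (upd bs k b k) by [].
rewrite /= (@state_ext k (upd vs k v) (upd bs k b) vs bs) => [|j jk].
  by rewrite /upd eqxx.
by rewrite /upd ltn_eqF.
Qed.

Lemma run_total k w : (\sum_i X k w i = n)%N.
Proof.
elim: k => // k IH; rewrite /X /run /= -/(run c V B k w) -/(X k w).
have [//|nf] := boolP (final _).
by rewrite rob_total //; exact: (robbing_rule VB nf).
Qed.

Lemma run_stationary k m w : (k <= m)%N -> final (X k w) -> X m w = X k w.
Proof.
move=> /subnK <- fk; elim: (m - k)%N => // i IH.
by rewrite addSn {1}/X /run /= -/(run c V B (i + k) w) -/(X (i + k) w) IH fk.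
Qed.

Lemma measurable_history k vs bs : measurable (history k vs bs).
Proof.
elim: k => [|k IH]; first by rewrite history0.
have -> : history k.+1 vs bs = history k vs bs `&` [set w | V k w = vs k]
    `&` [set w | B k w = bs k].
  rewrite -historyS; apply/seteqP; split=> w h j jk.
    by have := h j jk; rewrite /upd; case: eqP => [->|].
  by have := h j jk; rewrite /upd; case: eqP => [->|].
apply: measurableI; last exact: (robbing_measurable_flip VB).
by apply: measurableI => //; exact: (robbing_measurable_vertex VB).
Qed.

Lemma measurable_run k (Q : pred (configuration n)) :
  measurable [set w | Q (X k w)].
Proof.
elim: k Q => [|k IH] Q.
  have [Qc|Qc] := boolP (Q c).
    by rewrite (_ : mkset _ = setT) //; apply/seteqP; split.
  by rewrite (_ : mkset _ = set0) //; apply/seteqP; split=> w //=.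
pose F (i : 'I_n.+1 * bool) : set T :=
  [set w | Q (if final (X k w) then X k w else rob (X k w) i.1 i.2)] `&`
  [set w | V k w = i.1] `&` [set w | B k w = i.2].
have -> : [set w | Q (X k.+1 w)] = \bigcup_(i in [set: 'I_n.+1 * bool]) F i.
  apply/seteqP; split=> w /=.
    by move=> Qw; exists (V k w, B k w).
  by case=> -[v b] _ [[+ Vw] Bw]; rewrite /= in Vw Bw *; rewrite -Vw -Bw.
apply: fin_bigcup_measurable; first exact: finite_finset.
move=> i _; apply: measurableI; last exact: (robbing_measurable_flip VB).
apply: measurableI; last exact: (robbing_measurable_vertex VB).
exact: (IH (fun s => Q (if final s then s else rob s i.1 i.2))).
Qed.

Lemma measurable_ends_empty e : measurable (ends_empty c V B e).
Proof.
have -> : ends_empty c V B e =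
    \bigcup_k [set w | final (X k w) && (X k w e == 0%N)].
  apply/seteqP; split=> w.
    by move=> [k [fk /eqP ek]]; exists k => //=; apply/andP.
  by move=> [k _ /andP[? /eqP ?]]; exists k.
apply: bigcup_measurable => k _.
exact: (measurable_run k (fun s => final s && (s e == 0%N))).
Qed.

Lemma history_split k vs bs F : measurable F ->
  pr P (history k vs bs `&` F) =
  \sum_v \sum_b pr P (history k.+1 (upd vs k v) (upd bs k b) `&` F).
Proof.
move=> mF; have mA := measurable_history k vs bs.
rewrite (@pr_split _ _ _ P _ (V k)); last first.
- exact: (robbing_measurable_vertex VB).
- exact: measurableI.
apply: eq_bigr => v _; rewrite (@pr_split _ _ _ P _ (B k)); last first.
- exact: (robbing_measurable_flip VB).
- by apply: measurableI; [exact: measurableI|exact: (robbing_measurable_vertex VB)].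
apply: eq_bigr => b _; congr (pr P _); rewrite historyS.
by rewrite [_ `&` F `&` _]setIAC setIAC.
Qed.

Lemma history_flip k vs bs v b :
  pr P (history k.+1 (upd vs k v) (upd bs k b)) =
  pr P (history k vs bs `&` [set w | V k w = v]) / 2.
Proof.
rewrite historyS -past_upd /pr (robbing_fair VB) fineM //; last first.
  rewrite fin_num_measure // past_upd; apply: measurableI.
    exact: measurable_history.
  exact: (robbing_measurable_vertex VB).
by rewrite mulrC.
Qed.

Lemma history_step k vs bs (g : configuration n -> R) (delta : R) :
  let s := state c vs bs k in
  (~~ final s -> forall v, (2 <= s v)%N ->
     g (rob s v true) + g (rob s v false) <= (g s - delta) *+ 2) ->
  \sum_v \sum_b pr P (history k.+1 (upd vs k v) (upd bs k b)) *
      g (state c (upd vs k v) (upd bs k b) k.+1) <=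
  pr P (history k vs bs) * (g s - delta *+ ~~ final s).
Proof.
move=> s gs; have mA := measurable_history k vs bs.
have -> : pr P (history k vs bs) =
    \sum_v pr P (history k vs bs `&` [set w | V k w = v]).
  by apply: pr_split => //; exact: (robbing_measurable_vertex VB).
rewrite mulr_suml; apply: ler_sum => v _; rewrite big_bool !history_flip.
rewrite !state_upd /= -/s; case: (boolP (final s)) gs => [fs _|nfs /(_ isT) gs].
  by rewrite mulr0n subr0 -mulrDl -splitr.
have [sv|sv] := leqP 2 (s v).
  rewrite mulr1n -mulrDr -mulrA ler_wpM2l ?pr_ge0 //.
  by rewrite ler_pdivrMl // mulr_natl gs.
rewrite (_ : _ `&` _ = set0) ?pr0 ?mul0r ?addr0 //.
apply/seteqP; split=> w // -[hw /= Vw]; have := history_state hw.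
rewrite -/s => Xw; have := @robbing_rule _ _ _ _ _ _ _ _ VB k w.
by rewrite -/(X k w) Xw Vw => /(_ nfs); rewrite leqNgt sv.
Qed.
Definition running k : set T := [set w | ~~ final (X k w)].

Lemma measurable_running k : measurable (running k).
Proof. exact: (measurable_run k (fun s => ~~ final s)). Qed.

Lemma history_running k vs bs :
  pr P (history k vs bs `&` running k) =
  pr P (history k vs bs) *+ ~~ final (state c vs bs k).
Proof.
have [fs|nfs] := boolP (final _).
  rewrite (_ : _ `&` _ = set0) ?pr0 //; apply/seteqP; split=> w // -[hw].
  by rewrite /running /= (history_state hw) fs.
congr (pr P _); apply/seteqP; split=> w; first by case.
by move=> hw; split=> //; rewrite /running /= (history_state hw).
Qed.

Lemma final_ends_empty k vs bs e : final (state c vs bs k) ->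
  pr P (history k vs bs `&` ends_empty c V B e) =
  pr P (history k vs bs) *+ (state c vs bs k e == 0%N).
Proof.
move=> fs; case: eqP => [s0|s0].
  congr (pr P _); apply/seteqP; split=> w; first by case.
  move=> hw; split=> //; exists k.
  by rewrite -/(X k w) (history_state hw).
rewrite (_ : _ `&` _ = set0) ?pr0 //; apply/seteqP; split=> w // -[hw [m]].
rewrite -/(X m w) => -[fm m0]; apply: s0; rewrite -(history_state hw).
have [km|/ltnW mk] := leqP k m; last by rewrite (run_stationary mk fm).
by rewrite -(run_stationary km) // (history_state hw).
Qed.

(* Optional stopping after [j] more steps, conditionally on a history. *)
Lemma supermartingale_bound (g : configuration n -> R) (delta K M : R) e j k vs bs :
  (forall s v, (\sum_i s i = n)%N -> ~~ final s -> (2 <= s v)%N ->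
     g (rob s v true) + g (rob s v false) <= (g s - delta) *+ 2) ->
  (forall s, (\sum_i s i = n)%N -> ~~ final s -> `|K| - M <= g s) ->
  (forall s, (\sum_i s i = n)%N -> final s -> K *+ (s e == 0%N) <= g s) ->
  delta * (\sum_(i < j) pr P (history k vs bs `&` running (k + i))) +
    K * pr P (history k vs bs `&` ends_empty c V B e) -
    M * pr P (history k vs bs `&` running (k + j))
  <= pr P (history k vs bs) * g (state c vs bs k).
Proof.
move=> gstep grun gfinal; elim: j k vs bs => [|j IH] k vs bs.
  have [A0|/set0P[w hw]] := eqVneq (history k vs bs) set0.
    by rewrite big_ord0 A0 !set0I pr0 !mulr0 mul0r addr0 subr0.
  have sn : (\sum_i state c vs bs k i = n)%N.
    by rewrite -(history_state hw); exact: run_total.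
  rewrite big_ord0 mulr0 add0r addn0 history_running.
  have A0 := pr_ge0 P (history k vs bs).
  have [fs|nfs] := boolP (final _).
    rewrite mulr0n mulr0 subr0 final_ends_empty // mulrnAr -mulrnAl mulrC.
    by rewrite ler_wpM2l // gfinal.
  apply: le_trans (ler_wpM2l A0 (grun _ sn nfs)).
  rewrite mulr1n mulrBr [_ * M]mulrC lerB // mulrC.
  apply: le_trans (ler_norm _) _; rewrite normrM (ger0_norm (pr_ge0 _ _)).
  rewrite ler_wpM2r // pr_le //; last exact: measurable_history.
  by apply: measurableI; [exact: measurable_history|exact: measurable_ends_empty].
have [A0|/set0P[w hw]] := eqVneq (history k vs bs) set0.
  rewrite A0 !set0I pr0 big1 => [|i _]; last by rewrite set0I pr0.
  by rewrite !mulr0 mul0r addr0 subr0.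
have sn : (\sum_i state c vs bs k i = n)%N.
  by rewrite -(history_state hw); exact: run_total.
pose L (A : set T) := delta * (\sum_(i < j) pr P (A `&` running (k.+1 + i))) +
  K * pr P (A `&` ends_empty c V B e) - M * pr P (A `&` running (k.+1 + j)).
have -> : delta * (\sum_(i < j.+1) pr P (history k vs bs `&` running (k + i))) +
    K * pr P (history k vs bs `&` ends_empty c V B e) -
    M * pr P (history k vs bs `&` running (k + j.+1)) =
  pr P (history k vs bs) * (delta *+ ~~ final (state c vs bs k)) +
    L (history k vs bs).
  rewrite big_ord_recl addn0 history_running mulrDr addnS -addSn.
  rewrite mulrnAr [delta * _]mulrC -mulrnAr /L -!addrA; congr (_ + (_ * _ + _)).
  by apply: eq_bigr => i _; rewrite /= /bump addnS.
have -> : L (history k vs bs) =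
    \sum_v \sum_b L (history k.+1 (upd vs k v) (upd bs k b)).
  have ends_split := history_split k vs bs (measurable_ends_empty e).
  have run_split i := history_split k vs bs (measurable_running i).
  rewrite /L ends_split run_split.
  rewrite (eq_bigr _ (fun (i : 'I_j) _ => run_split (k.+1 + i)%N)).
  rewrite exchange_big /= !mulr_sumr -sumrN -!big_split; apply: eq_bigr => v _ /=.
  rewrite exchange_big /= !mulr_sumr -sumrN -!big_split; apply: eq_bigr => b _ /=.
  by rewrite mulr_sumr.
have step := history_step (fun nfs v => gstep _ v sn nfs).
have := lerD (lexx (pr P (history k vs bs) * (delta *+ ~~ final (state c vs bs k)))) step.
rewrite -mulrDr subrKC; apply: le_trans; rewrite lerD2l.
by apply: ler_sum => v _; apply: ler_sum => b _; exact: IH.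
Qed.

Lemma running_decreasing k m : (k <= m)%N -> running m `<=` running k.
Proof.
move=> km w; rewrite /running /=; apply: contraNN => fk.
by rewrite (run_stationary km fk).
Qed.

Lemma prT : pr P setT = 1. Proof. by rewrite /pr probability_setT. Qed.

Lemma pr_running_le j : pr P (running j) *+ j <= (potential c)%:R.
Proof.
have := @supermartingale_bound (fun s => (potential s)%:R) 1 0 0 ord0 j 0
  (fun=> ord0) (fun=> false).
rewrite history0 setTI prT !mul0r !mul1r addr0 subr0 /=; move=> h.
apply: le_trans (h _ _ _).
- rewrite (_ : _ *+ j = \sum_(i < j) pr P (running j)); last first.
    by rewrite sumr_const card_ord.
  rewrite subr0; apply: ler_sum => i _.
  rewrite setTI; apply: pr_le; rewrite ?add0n; do ?exact: measurable_running.
  by apply: running_decreasing; exact: ltnW.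
- move=> s v sn _ sv; rewrite mulrnBl lerBrDr -!natrD -mulrnA ler_nat.
  by rewrite muln2 potential_rob.
- by move=> s _ _; rewrite normr0.
- by move=> s _ _; rewrite mul0rn.
Qed.

Lemma total_le (s : configuration n) i : (\sum_i s i = n)%N -> (s i <= n)%N.
Proof. by move=> sn; rewrite -[leqRHS]sn (bigD1 i) //= leq_addr. Qed.

Lemma bounded_on_total (h : configuration n -> R) :
  exists M : R, forall s, (\sum_i s i = n)%N -> `|h s| <= M.
Proof.
pose F (f : {ffun 'I_n.+1 -> 'I_n.+1}) : configuration n := [ffun i => f i : nat].
exists (\sum_f `|h (F f)|) => s sn.
have -> : s = F [ffun i => inord (s i)].
  by apply/ffunP => i; rewrite !ffunE inordK // ltnS total_le.
by rewrite (bigD1 [ffun i => inord (s i)]) //= lerDl sumr_ge0.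
Qed.

Lemma harmonic_ends_empty (h : configuration n -> R) (K : R) e :
  (forall s v, (\sum_i s i = n)%N -> (2 <= s v)%N ->
     h (rob s v true) + h (rob s v false) = h s *+ 2) ->
  (forall s, (\sum_i s i = n)%N -> final s -> h s = K *+ (s e == 0%N)) ->
  h c = K * pr P (ends_empty c V B e).
Proof.
move=> hharm hfinal; have [M hM] := bounded_on_total h.
have one_sided (h' : configuration n -> R) K' :
    (forall s v, (\sum_i s i = n)%N -> (2 <= s v)%N ->
       h' (rob s v true) + h' (rob s v false) = h' s *+ 2) ->
    (forall s, (\sum_i s i = n)%N -> final s -> h' s = K' *+ (s e == 0%N)) ->
    (forall s, (\sum_i s i = n)%N -> `|h' s| <= M) ->
    K' * pr P (ends_empty c V B e) <= h' c.
  move=> harm' final' M'; rewrite leNgt; apply/negP => lt.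
  set p := pr P _ in lt; pose N := `|K'| + M; pose x := K' * p - h' c.
  have x0 : 0 < x by rewrite subr_gt0.
  have N0 : 0 <= N.
    by rewrite addr_ge0 // (le_trans _ (M' c c_total)).
  have bound j : x <= N * pr P (running j).
    have := @supermartingale_bound h' 0 K' N e j 0 (fun=> ord0) (fun=> false).
    rewrite history0 !setTI prT mul0r mul1r add0r add0n /= -/p => H.
    rewrite /x lerBlDl -lerBlDr; apply: H.
    - by move=> s v sn _ sv; rewrite subr0 harm'.
    - move=> s sn _; rewrite /N opprD addNKr.
      by rewrite lerNl (le_trans (ler_norm _)) // normrN M'.
    - by move=> s sn fs; rewrite final'.
  have Psi0 : 0 <= N * (potential c)%:R / x by rewrite divr_ge0 ?mulr_ge0 // ltW.
  pose j := Num.bound (N * (potential c)%:R / x).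
  have := archi_boundP Psi0; rewrite -/j ltr_pdivrMr // ltNge => /negP; apply.
  rewrite mulr_natl (le_trans (ler_wMn2r _ (bound j))) // -mulrnAr ler_wpM2l //.
  exact: pr_running_le.
apply/eqP; rewrite eq_le one_sided // andbT.
rewrite -lerN2 -mulNr; apply: (one_sided (fun s => - h s)).
- by move=> s v sn sv; rewrite -opprD hharm // mulNrn.
- by move=> s sn fs; rewrite hfinal // mulNrn.
- by move=> s sn; rewrite normrN hM.
Qed.
End Histories.

Theorem theorem5 (R : realType) (n : nat) (hn : (1 <= n)%N)
  (c : configuration n) (hc : (\sum_(i < n.+1) c i = n)%N)
  (d : measure_display) (T : measurableType d) (P : probability T R)
  (V : nat -> T -> 'I_n.+1) (B : nat -> T -> bool)
  (hVB : robbing_process P c V B) :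
  cstfun n (fine (P (ends_empty c V B ord_max))) =
  (n`!%:R)^-1 * Phi (\prod_(i < n.+1) ypoly R i ^+ c i).
Proof.
rewrite Phi_antisym -/(Phinum _) -/(ymonom R c) -/(pr P _).
set p := pr P _.
have -> : Phinum (ymonom R c) = (n`!%:R * p) *: vandermonde R n.
  apply/mpolyP => m; rewrite mcoeffZ mulrAC.
  apply: (harmonic_ends_empty hc hVB
    (h := fun s => (Phinum (ymonom R s))@_m)) => [s v sn sv|s sn fs].
    by rewrite -mcoeffD Phinum_rob // mcoeffMn.
  by rewrite Phinum_final // mcoeffZ mulnC natrM mulr_natr mulrnAl.
have polyfun_neq0 q : q != 0 -> polyfun q != 0 by rewrite /polyfun tofrac_eq0.
rewrite -mul_mpolyC /polyfun tofracM mulfK ?polyfun_neq0 ?vandermonde_neq0 //.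
rewrite mpolyCM tofracM mpolyC_nat rmorph_nat mulKf //.
rewrite -[n`!%:R](rmorph_nat (@FracField.tofrac _)) polyfun_neq0 //.
by rewrite -mpolyC_nat mpolyC_eq0 pnatr_eq0 -lt0n fact_gt0.
Qed.
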